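(* The extension $\mathsf{HLC}^\sharp+\mathsf{sU}$ of $\mathsf{HLC}^\sharp$ by the strong uniqueness principle $\mathsf{sU}$ proves the strong Löb principle: for every formula $\phi$ of $\mathbb L(\rightsquigarrow)$, $$\mathsf{HLC}^\sharp+\mathsf{sU}\vdash(\Box\phi\to\phi)\to\phi.$$
   Context: Formulas of $\mathbb L(\rightsquigarrow)$ are built from propositional variables, $\top,\bot$, and binary connectives $\wedge,\vee,\to,\rightsquigarrow$. Abbreviations: $(\phi\leftrightarrow\psi):=((\phi\to\psi)\wedge(\psi\to\phi))$ and $\Box\phi:=(\top\rightsquigarrow\phi)$. $\chi[r:\phi]$ denotes the result of substituting $\phi$ for $r$ in $\chi$. A formula $\chi$ is modalised in $r$ if every occurrence of $r$ in $\chi$ is in the scope of an occurrence of $\rightsquigarrow$. The system $\mathsf{HLC}^\sharp$ is axiomatised by all axioms and rules of intuitionistic propositional logic, the rule: from $\vdash\phi\to\psi$ infer $\vdash\phi\rightsquigarrow\psi$, and the axiom schemes $((\phi\rightsquigarrow\psi)\wedge(\psi\rightsquigarrow\chi))\to(\phi\rightsquigarrow\chi)$, $((\phi\rightsquigarrow\psi)\wedge(\phi\rightsquigarrow\chi))\to(\phi\rightsquigarrow(\psi\wedge\chi))$, $((\phi\rightsquigarrow\chi)\wedge(\psi\rightsquigarrow\chi))\to((\phi\vee\psi)\rightsquigarrow\chi)$. The principle $\mathsf{sU}$ consists of all formulas $$\big((\phi\leftrightarrow\chi[r:\phi])\wedge(\psi\leftrightarrow\chi[r:\psi])\big)\to(\phi\leftrightarrow\psi),$$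 where $r$ is a propositional variable, $\chi$ is modalised in $r$, and $\phi,\psi$ are arbitrary formulas. $\mathsf{HLC}^\sharp+\mathsf{sU}$ is $\mathsf{HLC}^\sharp$ with these added as axioms (all rules applying to the extended system). *)

(* Defs.v *)
From Stdlib Require Import Arith.

Definition var := nat.

Inductive form : Type :=
| Var (p : var)
| Top
| Bot
| And (phi psi : form)
| Or (phi psi : form)
| Imp (phi psi : form)
| Arr (phi psi : form).

Declare Scope form_scope.
Delimit Scope form_scope with form.
Bind Scope form_scope with form.
Local Open Scope form_scope.

Notation "⊤" := Top (at level 0) : form_scope.
Notation "⊥" := Bot (at level 0) : form_scope.
Notation "phi ∧ psi" := (And phi psi) (at level 45, right associativity) : form_scope.
Notation "phi ∨ psi" := (Or phi psi) (at level 50, left associativity) : form_scope.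
Notation "phi ⇝ psi" := (Arr phi psi) (at level 53, no associativity) : form_scope.
Notation "phi → psi" := (Imp phi psi) (at level 55, right associativity) : form_scope.

Definition Iff (phi psi : form) : form := (phi → psi) ∧ (psi → phi).
Notation "phi ↔ psi" := (Iff phi psi) (at level 57, no associativity) : form_scope.

Definition Box (phi : form) : form := ⊤ ⇝ phi.
Notation "□ phi" := (Box phi) (at level 35, right associativity) : form_scope.

Fixpoint subst (chi : form) (r : var) (phi : form) : form :=
  match chi with
  | Var p => if Nat.eqb p r then phi else Var p
  | Top => Top
  | Bot => Bot
  | And a b => And (subst a r phi) (subst b r phi)
  | Or a b => Or (subst a r phi) (subst b r phi)
  | Imp a b => Imp (subst a r phi) (subst b r phi)
  | Arr a b => Arr (subst a r phi) (subst b r phi)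
  end.
Notation "chi [ r ≔ phi ]" := (subst chi r phi)
  (at level 2, left associativity, format "chi [ r  ≔  phi ]") : form_scope.

Fixpoint modalised (r : var) (chi : form) : Prop :=
  match chi with
  | Var p => p <> r
  | Top | Bot => True
  | And a b | Or a b | Imp a b => modalised r a /\ modalised r b
  | Arr _ _ => True
  end.

(* [HLCsharp X phi]: theoremhood in the extension of HLC♯ by the formulas in
   [X] as axioms; HLC♯ itself is the case of empty [X].  Since the axioms are
   schemes, no substitution rule is included. *)
Inductive HLCsharp (X : form -> Prop) : form -> Prop :=
| ax_extra phi : X phi -> HLCsharp X phi
| ax_K phi psi : HLCsharp X (phi → psi → phi)
| ax_S phi psi chi :
    HLCsharp X ((phi → psi → chi) → (phi → psi) → phi → chi)
| ax_and_l phi psi : HLCsharp X (phi ∧ psi → phi)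
| ax_and_r phi psi : HLCsharp X (phi ∧ psi → psi)
| ax_and_intro phi psi : HLCsharp X (phi → psi → phi ∧ psi)
| ax_or_l phi psi : HLCsharp X (phi → phi ∨ psi)
| ax_or_r phi psi : HLCsharp X (psi → phi ∨ psi)
| ax_or_elim phi psi chi :
    HLCsharp X ((phi → chi) → (psi → chi) → phi ∨ psi → chi)
| ax_bot phi : HLCsharp X (⊥ → phi)
| ax_top : HLCsharp X ⊤
| ax_arr_trans phi psi chi :
    HLCsharp X ((phi ⇝ psi) ∧ (psi ⇝ chi) → (phi ⇝ chi))
| ax_arr_and phi psi chi :
    HLCsharp X ((phi ⇝ psi) ∧ (phi ⇝ chi) → (phi ⇝ (psi ∧ chi)))
| ax_arr_or phi psi chi :
    HLCsharp X ((phi ⇝ chi) ∧ (psi ⇝ chi) → ((phi ∨ psi) ⇝ chi))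
| rule_mp phi psi :
    HLCsharp X (phi → psi) -> HLCsharp X phi -> HLCsharp X psi
| rule_arr phi psi :
    HLCsharp X (phi → psi) -> HLCsharp X (phi ⇝ psi).

Inductive sU : form -> Prop :=
| sU_intro (r : var) (chi phi psi : form) :
    modalised r chi ->
    sU (((phi ↔ chi[r ≔ phi]) ∧ (psi ↔ chi[r ≔ psi])) → (phi ↔ psi)).

(* Main.v *)
From Stdlib Require Import Arith Lia.
Require Import Defs.
Local Open Scope form_scope.

(** For a variable [r] not occurring in [phi], the formula [phi ∨ □ r] is
    modalised in [r].  As a map of [r] it has [⊤] as a fixed point outright,
    since [□ ⊤] is a theorem, and it has [phi] as a fixed point exactly when
    [□ phi → phi] holds.  Strong uniqueness identifies the two fixed points:
    under the hypothesis [□ phi → phi], [phi] is equivalent to [⊤].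

    The disjunction is what makes this work without [phi → □ phi]: for the
    simpler map [□ r], that [phi] is a fixed point would require it.

    Since [rule_arr] applies only to theorems, the hypothesis is carried as the
    antecedent [gamma] of an implication, on which [imp_weaken] and [imp_mp]
    operate; no deduction theorem is involved. *)

Fixpoint fresh (r : var) (phi : form) : Prop :=
  match phi with
  | Var p => p <> r
  | Top | Bot => True
  | And a b | Or a b | Imp a b | Arr a b => fresh r a /\ fresh r b
  end.

Lemma fresh_modalised r phi : fresh r phi -> modalised r phi.
Proof. induction phi; simpl; tauto. Qed.

Lemma subst_fresh r phi psi : fresh r phi -> phi[r ≔ psi] = phi.
Proof.
  induction phi; simpl; intros H; try reflexivity;
    try (destruct H; f_equal; auto; fail).
  now apply Nat.eqb_neq in H; rewrite H.
Qed.

Lemma eventually_fresh phi : exists n, forall r, n <= r -> fresh r phi.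
Proof.
  induction phi as
    [p | | | a [n Hn] b [m Hm] | a [n Hn] b [m Hm]
     | a [n Hn] b [m Hm] | a [n Hn] b [m Hm]]; simpl;
    try (exists (n + m); intros r Hr; split; [apply Hn | apply Hm]; lia).
  - exists (S p); intros r Hr; lia.
  - now exists 0.
  - now exists 0.
Qed.

Section Derivations.
Variable X : form -> Prop.
Implicit Types gamma a b c : form.

Lemma imp_weaken gamma a : HLCsharp X a -> HLCsharp X (gamma → a).
Proof. apply rule_mp, ax_K. Qed.

Lemma imp_mp gamma a b :
  HLCsharp X (gamma → a → b) -> HLCsharp X (gamma → a) ->
  HLCsharp X (gamma → b).
Proof.
  intros Hab; apply rule_mp; exact (rule_mp _ _ _ (ax_S _ _ _ _) Hab).
Qed.

Lemma imp_refl a : HLCsharp X (a → a).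
Proof. exact (imp_mp _ _ _ (ax_K _ a (a → a)) (ax_K _ a a)). Qed.

Lemma imp_and gamma a b :
  HLCsharp X (gamma → a) -> HLCsharp X (gamma → b) ->
  HLCsharp X (gamma → a ∧ b).
Proof.
  intros Ha; apply imp_mp, (imp_mp _ a); trivial.
  apply imp_weaken, ax_and_intro.
Qed.

Lemma imp_or_elim gamma a b c :
  HLCsharp X (gamma → a → c) -> HLCsharp X (gamma → b → c) ->
  HLCsharp X (gamma → a ∨ b → c).
Proof.
  intros Ha; apply imp_mp, (imp_mp _ (a → c)); trivial.
  apply imp_weaken, ax_or_elim.
Qed.

Lemma box_top : HLCsharp X (□ ⊤).
Proof. apply rule_arr, imp_refl. Qed.

Lemma lob_hyp_fixpoint phi :
  HLCsharp X ((□ phi → phi) → (phi ↔ (phi ∨ □ phi))).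
Proof.
  apply imp_and.
  - apply imp_weaken, ax_or_l.
  - apply imp_or_elim; [apply imp_weaken |]; apply imp_refl.
Qed.

Lemma top_fixpoint phi : HLCsharp X (⊤ ↔ (phi ∨ □ ⊤)).
Proof.
  eapply rule_mp; [eapply rule_mp; [apply ax_and_intro |] |].
  - apply imp_weaken; exact (rule_mp _ _ _ (ax_or_r _ _ _) box_top).
  - apply imp_weaken, ax_top.
Qed.

End Derivations.

(** The instance of strong uniqueness for the map [phi ∨ □ r]; taking [r]
    fresh keeps [phi] itself untouched by the substitutions. *)
Lemma sU_or_box phi a b :
  HLCsharp sU (((a ↔ (phi ∨ □ a)) ∧ (b ↔ (phi ∨ □ b))) → (a ↔ b)).
Proof.
  destruct (eventually_fresh phi) as [r Hr]; specialize (Hr r (le_n r)).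
  pose proof (sU_intro r (phi ∨ □ (Var r)) a b
                (conj (fresh_modalised _ _ Hr) I)) as H.
  simpl in H; rewrite Nat.eqb_refl, !subst_fresh in H by exact Hr.
  exact (ax_extra _ _ H).
Qed.

Theorem theorem3p8 : forall phi : form, HLCsharp sU ((□ phi → phi) → phi).
Proof.
  intros phi.
  apply (imp_mp _ _ ⊤); [| apply imp_weaken, ax_top].
  apply (imp_mp _ _ (phi ↔ ⊤)); [apply imp_weaken, ax_and_r |].
  eapply imp_mp; [apply imp_weaken, (sU_or_box phi) |].
  apply imp_and; [apply lob_hyp_fixpoint | apply imp_weaken, top_fixpoint].
Qed.
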